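(* Let $0<\varepsilon\le1$ and let $\mathfrak{K}_\varepsilon$ be the linear span of $\{x^n e^{-x^2/(2\sqrt\varepsilon)} : n\in\{0,1,2,\dots\}\}$. Then $\mathfrak{K}_\varepsilon\cap D(S_\varepsilon)=\{0\}$ and $\mathfrak{K}_\varepsilon\cap D(S^*_\varepsilon)=\{0\}$.
   Context: Work in $L^2(\mathbb{R})$ with inner product $(f,g)=\int\overline{f}g\,dx$. Let $q$ be multiplication by $x$ and $p=-i\,d/dx$ (both self-adjoint; $q$ injective). Let $t=q^{-1}p$ with $D(t)=\{f\in D(p): pf\in D(q^{-1})\}$, and $t^*$ its adjoint. Let $L^2_0$ and $L^2_1$ be the subspaces of even and odd functions. Define $S_\varepsilon$ in $L^2_0$ by $D(S_\varepsilon)=\{f\in L^2_0\cap\bigcap_{n\ge0}D(t^{2n+1}): \lim_{N\to\infty}\sum_{n=0}^N\frac{(-1)^n}{2n+1}(\sqrt\varepsilon t)^{2n+1}f$ exists in norm$\}$ and $S_\varepsilon f=-\varepsilon^{-1/2}\sum_{n=0}^\infty\frac{(-1)^n}{2n+1}(\sqrt\varepsilon t)^{2n+1}f$. Define $S^*_\varepsilon$ (notation only, not an adjoint) in $L^2_1$ by the same formulas with $t$ replaced by $t^*$ and $L^2_0$ replaced by $L^2_1$. *)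

(* Defs.v *)
From HB Require Import structures.
From mathcomp Require Import all_boot all_order all_algebra.
From mathcomp Require Import all_classical all_reals all_analysis.
From mathcomp Require Import complex.
Import Order.TTheory GRing.Theory Num.Theory.

Set Implicit Arguments.
Unset Strict Implicit.
Unset Printing Implicit Defensive.

Local Open Scope ring_scope.
Local Open Scope classical_set_scope.

Section Defs.
Variable R : realType.

Local Notation C := (R[i]).
Local Notation leb := (@lebesgue_measure R).

Definition reF (f : R -> C) : R -> R := fun x => complex.Re (f x).
Definition imF (f : R -> C) : R -> R := fun x => complex.Im (f x).

Definition cint (F : R -> C) : C :=
  ((Rintegral leb setT (reF F)) +i* (Rintegral leb setT (imF F)))%C.

Definition l2norm2 (f : R -> C) : \bar R :=
  (\int[leb]_x (((reF f x) ^+ 2 + (imF f x) ^+ 2)%:E))%E.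

Definition L2 (f : R -> C) : Prop :=
  measurable_fun setT (reF f) /\ measurable_fun setT (imF f) /\
  (l2norm2 f < +oo)%E.

Definition inner (f g : R -> C) : C := cint (fun x => ((f x)^* * g x)%C).

(* Operators on L^2(R) are represented by their graphs, as relations between
   representatives; all graphs below are invariant under a.e. equality. *)
Definition op := (R -> C) -> (R -> C) -> Prop.

Definition idop : op := fun f g => L2 f /\ L2 g /\ {ae leb, forall x, f x = g x}.

Fixpoint oppow (n : nat) (T : op) : op :=
  match n with
  | O => idop
  | S m => fun f h => exists g, T f g /\ oppow m T g h
  end.

Definition opscale (a : C) (T : op) : op :=
  fun f h => exists g, T f g /\ h = (fun x => a * g x).

Definition smooth (u : R -> R) : Prop :=
  forall (n : nat) (x : R), derivable (iter n (@derive1 R R) u) x 1.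
Definition compact_support (u : R -> R) : Prop :=
  exists M : R, forall x, M < `|x| -> u x = 0.
Definition test_fun (phi : R -> C) : Prop :=
  smooth (reF phi) /\ smooth (imF phi) /\
  compact_support (reF phi) /\ compact_support (imF phi).
Definition cderiv (phi : R -> C) : R -> C :=
  fun x => ((derive1 (reF phi) x) +i* (derive1 (imF phi) x))%C.

(* momentum operator p = -i d/dx, self-adjoint on H^1(R) = {f in L^2 : f' in L^2}
   (weak derivative):  p f = g  iff  f' = i g weakly, i.e.
   \int f phi' = - \int (i g) phi  for all test functions phi. *)
Definition pop : op := fun f g =>
  L2 f /\ L2 g /\
  forall phi, test_fun phi ->
    cint (fun x => f x * cderiv phi x) = - cint (fun x => 'i%C * g x * phi x).

Definition qop : op := fun f g =>
  L2 f /\ L2 g /\ {ae leb, forall x, g x = (x%:C)%C * f x}.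

Definition qinv : op := fun g f => qop f g.

Definition top : op := fun f h => exists g, pop f g /\ qinv g h.

Definition tstar : op := fun g h =>
  L2 g /\ L2 h /\ forall f k, top f k -> inner k g = inner f h.

Definition L2even (f : R -> C) : Prop := L2 f /\ {ae leb, forall x, f (- x) = f x}.
Definition L2odd (f : R -> C) : Prop := L2 f /\ {ae leb, forall x, f (- x) = - f x}.

Definition L2cvg (s : nat -> R -> C) (g : R -> C) : Prop :=
  L2 g /\ (forall N, L2 (s N)) /\
  ((fun N => l2norm2 (fun x => s N x - g x)) @ \oo --> 0%E).

Definition Sdom (T : op) (Lsub : (R -> C) -> Prop) (eps : R) (f : R -> C) : Prop :=
  Lsub f /\
  (forall n : nat, exists h, oppow (2 * n + 1) T f h) /\
  exists hs : nat -> R -> C,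
    (forall n : nat,
        oppow (2 * n + 1) (opscale ((Num.sqrt eps)%:C)%C T) f (hs n)) /\
    exists g : R -> C,
      L2cvg (fun N x => \sum_(n < N.+1)
                (((-1) ^+ n / (2 * n + 1)%:R)%:C)%C * hs n x) g.

Definition DS (eps : R) := Sdom top L2even eps.
Definition DSstar (eps : R) := Sdom tstar L2odd eps.

Definition Kspan (eps : R) : set (R -> C) :=
  [set f | exists (N : nat) (c : 'I_N -> C), forall x : R,
      f x = \sum_(i < N) c i * ((x%:C)%C) ^+ i *
              ((expR (- x ^+ 2 / (2 * Num.sqrt eps)))%:C)%C].

End Defs.

(* Main.v *)
(* Nothing has to be known about the domains of the powers of t beyond the weak
   form of t on test functions supported in (1, 2): if k = t f then
   int k psi = i int f A psi with A psi = (psi / x)', and if k = t^* f the same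
   holds with A psi = psi' / x.  Put a = sqrt eps and e = exp (- x^2 / (2 a)).
   Integration by parts gives
   int Q(x^2) e (a A psi) = int (Q - 2 a Q')(x^2) e psi (in the odd case with an
   additional factor x), so if the partial sums of the series defining S f are
   bounded when tested against every psi, then so are the sums
   sum_n (2 n + 1)^-1 int Q(x^2) e (a A)^(2 n + 1) psi, and this property passes
   from Q to Q'.  Differentiating down to a nonzero constant Q, the sum becomes
   Q * int e psi * sum_n (2 n + 1)^-1, which diverges. *)
Require Import Defs.
From HB Require Import structures.
From mathcomp Require Import all_boot all_order all_algebra.
From mathcomp Require Import all_classical all_reals all_analysis.
From mathcomp Require Import complex.
From mathcomp Require Import measurable_realfun zify ring lra.
Import Order.TTheory GRing.Theory Num.Theory.
Import numFieldNormedType.Exports.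
Local Open Scope ring_scope.
Local Open Scope classical_set_scope.

(** * Smooth test functions vanishing off the interval (1, 2) *)

Section Bump.
Variable R : realType.
Implicit Types (P Q : {poly R}) (k n : nat) (x : R).

Definition window : {poly R} := ('X - 1) * (2%:P - 'X).

Lemma windowE x : window.[x] = (x - 1) * (2 - x).
Proof. by rewrite /window !hornerE. Qed.

(* These test functions are stable under d/dx and under division by x. *)
Definition bump P k x : R :=
  if 1 < x < 2 then P.[x] / ('X * window).[x] ^+ k * expR (- window.[x]^-1)
  else 0.

(** Comes from exp y >= y^(n+1) / (n+1)! at y = 1 / w. It makes the exponential in [bump] beat every
    power of the denominator at the endpoints. *)
Lemma expRNV_le n (w : R) : 0 < w -> expR (- w^-1) <= n.+1`!%:R * w ^+ n.+1.
Proof.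
move=> w0; rewrite expRN -[leRHS]invrK lef_pV2 ?posrE ?expR_gt0//; last first.
  by rewrite invr_gt0 mulr_gt0 ?ltr0n ?fact_gt0 ?exprn_gt0.
apply: le_trans (expR_ge1Dxn n _); last by rewrite invr_ge0 ltW.
by rewrite invfM mulrC -exprVn lerDr.
Qed.

Lemma poly_bounded P (b : R) : exists2 M : R, 0 <= M &
  forall x, `|x| <= b -> `|P.[x]| <= M.
Proof.
elim/poly_ind: P => [|p c [M M0 IH]]; first by exists 0 => // x _; rewrite horner0 normr0.
exists (M * `|b| + `|c|); first by rewrite addr_ge0 ?mulr_ge0.
move=> x xb; rewrite !hornerE (le_trans (ler_normD _ _))// lerD2r normrM.
by rewrite ler_pM ?IH// (le_trans xb)// ler_norm.
Qed.

(** On (1, 2) the numerator is bounded, x >= 1, and the exponential supplies enough powers of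
    [window], both of whose factors lie in [0, 1]. The quadratic bounds serve to differentiate at 1
    and 2. *)
Lemma bump_bound P k : exists2 C : R, 0 <= C &
  forall x, `|bump P k x| <= C * ((x - 1) ^+ 2) /\ `|bump P k x| <= C * ((x - 2) ^+ 2).
Proof.
have [M M0 PM] := poly_bounded P 2.
pose C := M * k.+2`!%:R; exists C; first by rewrite mulr_ge0.
move=> x; rewrite /bump; case: ifPn => [/andP[x1 x2]|_]; last first.
  by rewrite normr0; split; apply: mulr_ge0 (sqr_ge0 _); apply: mulr_ge0.
suff H : `|P.[x] / ('X * window).[x] ^+ k * expR (- window.[x]^-1)| <= C * (window.[x] ^+ 2).
  split; apply: (le_trans H); rewrite ler_wpM2l ?mulr_ge0// windowE exprMn.
    by rewrite ler_piMr ?sqr_ge0//; nra.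
  by rewrite -[leRHS]mul1r -[(2 - x) ^+ 2]sqrrN opprB ler_wpM2r ?sqr_ge0//; nra.
have w0 : 0 < window.[x] by rewrite windowE; nra.
rewrite !normrM -mulrA /C -[leRHS]mulrA; apply: ler_pM => //.
  by apply: PM; rewrite ger0_norm; lra.
rewrite (ger0_norm (expR_ge0 _)) normfV normrX hornerM hornerX.
rewrite ger0_norm ?mulr_ge0//; [|lra|exact: ltW].
rewrite -ler_pdivlMl ?invr_gt0 ?exprn_gt0 ?mulr_gt0//; last by lra.
(* Of the k + 2 powers of [window] obtained, k cancel the denominator and two give the quadratic
   bound; the leftover factor x^k is at least 1. *)
rewrite invrK (le_trans (expRNV_le k.+1 _ w0))// exprMn [leRHS]mulrCA.
rewrite ler_wpM2l// -[leRHS]mulrA -exprD addn2.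
by rewrite ler_peMl ?exprn_ge0 ?exprn_ege1// ltW.
Qed.

(** The slope f z / (z - c) is a Caratheodory function for f at c: it is at most C |z - c| in
    absolute value, and at z = c it is 0 / 0 = 0, the claimed derivative. *)
Lemma is_derive_sqr_bound (f : R -> R) (c C : R) :
  (forall x, `|f x| <= C * (x - c) ^+ 2) -> is_derive c 1 f 0.
Proof.
move=> fC.
have fc : f c = 0.
  by apply/eqP; rewrite -normr_le0 (le_trans (fC c))// subrr expr0n mulr0.
apply/is_derive1_caratheodory; exists (fun z => f z / (z - c)); split.
- move=> z; rewrite fc subr0; have [->|zc] := eqVneq z c; first by rewrite fc !mul0r.
  by rewrite divfK// subr_eq0.
- rewrite /prop_for /continuous_at /= fc mul0r.
  apply/cvgr0Pnorm_le => e e0; near=> z.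
  have [->|zc] := eqVneq z c; first by rewrite fc mul0r normr0 ltW.
  have d0 : 0 < `|z - c| by rewrite normr_gt0 subr_eq0.
  rewrite normrM normfV ler_pdivrMr// (le_trans (fC z))//.
  rewrite -real_normK ?num_real// expr2 mulrA ler_wpM2r//.
  (* The constant may be 0; adding 1 to its absolute value makes it safe to divide by. *)
  have C0 : 0 < `|C| + 1 by rewrite ltr_wpDl.
  rewrite (@le_trans _ _ ((`|C| + 1) * `|z - c|))//.
    by rewrite ler_wpM2r// (le_trans (ler_norm C))// lerDl.
  rewrite -ler_pdivlMl//.
  near: z; apply/nbhs_ballP; exists ((`|C| + 1)^-1 * e).
    by rewrite /= mulr_gt0 ?invr_gt0.
  by move=> z /ltW; rewrite distrC.
- by rewrite /= fc mul0r.
Unshelve. all: by end_near. Qed.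

Local Notation den := ('X * window).

(** Numerator of the derivative of [bump P k] over the common denominator den^(k+2). The last term
    comes from the exponential, where 1 / window^2 = x^2 / den^2. *)
Definition bump' P k : {poly R} :=
  P^`() * den ^+ 2 - (P * den^`() * den) *+ k + P * window^`() * 'X ^+ 2.

Lemma horner_bump' P k x : (bump' P k).[x] =
  P^`().[x] * den.[x] ^+ 2 - (P.[x] * den^`().[x] * den.[x]) *+ k
  + P.[x] * window^`().[x] * x ^+ 2.
Proof.
rewrite /bump'; move: den window => d w.
by rewrite !(hornerD, hornerN, hornerMn, hornerM, horner_exp, hornerX).
Qed.

Lemma bump_in P k x : 1 < x < 2 ->
  bump P k x = P.[x] / den.[x] ^+ k * expR (- window.[x]^-1).
Proof. by rewrite /bump => ->. Qed.

Lemma bump_out P k x : ~~ (1 < x < 2) -> bump P k x = 0.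
Proof. by rewrite /bump => /negbTE->. Qed.

Lemma window_gt0 x : 1 < x < 2 -> 0 < window.[x].
Proof. by move=> /andP[? ?]; rewrite windowE; nra. Qed.

(** Inside (1, 2) this is the usual calculus; at 1 and 2 the quadratic bound forces derivative 0;
    elsewhere the function is locally 0. *)
Lemma is_derive_bump P k x :
  is_derive x 1 (bump P k) (bump (bump' P k) k.+2 x).
Proof.
have [x12|x12] := boolP (1 < x < 2).
  have w0 := window_gt0 _ x12.
  have x0 : 0 < x by case/andP: x12 => x1 _; lra.
  have d0 : 0 < den.[x] by rewrite hornerM hornerX mulr_gt0.
  rewrite bump_in//.
  apply: (@near_eq_is_derive _ _ _
    (fun y => P.[y] / den.[y] ^+ k * expR (- window.[y]^-1))).
    have x12i : x \in `]1, 2[%R by rewrite in_itv.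
    near=> y; rewrite bump_in//.
    have : y \in `]1, 2[%R by near: y; exact: near_in_itvoo.
    by rewrite in_itv.
  have dE : is_derive x 1 (fun y => den.[y] ^+ k) (den^`().[x] * den.[x] ^+ k.-1 *+ k).
    rewrite (_ : (fun y => _) = horner (den ^+ k)); last first.
      by apply/funext => y; rewrite horner_exp.
    apply: is_derive_eq.
    by rewrite deriv_exp hornerMn hornerM horner_exp.
  have wE : is_derive x 1 (fun y => - window.[y]^-1) (window^`().[x] / window.[x] ^+ 2).
    apply: is_derive_eq; first by apply: is_deriveN; apply: is_deriveV; rewrite ?gt_eqF.
    by rewrite scaleNr opprK /GRing.scale /= mulrC.
  have DV : is_derive x 1 (fun y => (den.[y] ^+ k)^-1) (- (den^`().[x] / den.[x] ^+ k.+1) *+ k).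
    apply: is_derive_eq; first by apply: is_deriveV; rewrite ?gt_eqF// exprn_gt0.
    case: (k) => [|j]; first by rewrite [RHS]mulr0n [X in _ *: X]mulr0n scaler0.
    rewrite /GRing.scale /= -[X in _ * X]mulr_natr -[RHS]mulr_natr !exprS.
    have D : den.[x] ^+ j != 0 by rewrite expf_neq0// gt_eqF.
    by field; rewrite D gt_eqF.
  have EV := @is_derive1_comp _ expR (fun y => - window.[y]^-1) x _ _ (is_derive_expR (- window.[x]^-1)) wE.
  have PEV : is_derive x 1 (fun y => P.[y] / den.[y] ^+ k * expR (- window.[y]^-1))
      (P.[x] / den.[x] ^+ k * (expR (- window.[x]^-1) * (window^`().[x] / window.[x] ^+ 2)) +
       expR (- window.[x]^-1) * (P.[x] * (- (den^`().[x] / den.[x] ^+ k.+1) *+ k) +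
        den.[x] ^- k * P^`().[x])) :=
    is_deriveM (is_deriveM (is_derive_poly P x) DV) EV.
  apply: (is_derive_eq PEV).
  rewrite horner_bump'.
  (* Eliminating [window] turns the goal into a field identity whose denominators are x and powers
     of [den]. *)
  have -> : window.[x] = den.[x] / x by rewrite [den.[x]]hornerM hornerX mulrC mulKf ?gt_eqF.
  set e := expR _; move: e (P.[x]) (P^`().[x]) (den.[x]) d0 (den^`().[x]) (window^`().[x]) => e p p' d d0 d' w'.
  have D : d ^+ k != 0 by rewrite expf_neq0// gt_eqF.
  (* The k-fold sums become products with a scalar, which [field] can treat as an atom. *)
  have [c kc] : exists c, forall y : R, y *+ k = y * c.
    by exists k%:R => y; rewrite mulr_natr.
  rewrite !kc !exprS; move: D; move: (d ^+ k) => dk D.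
  by field; rewrite D !gt_eqF.
have out (z : R) : ~~ (1 < z < 2) -> z != 1 -> z != 2 -> z < 1 \/ 2 < z.
  rewrite negb_and -!leNgt !neq_lt => /orP[z1|z2].
    by move=> /orP[|/lt_geF]; [left|rewrite z1].
  by move=> _ /orP[/lt_geF|]; [rewrite z2|right].
rewrite bump_out//.
have [C _ bC] := bump_bound P k.
have [->|x1] := eqVneq x 1; first by apply: is_derive_sqr_bound => y; exact: (bC y).1.
have [->|x2] := eqVneq x 2; first by apply: is_derive_sqr_bound => y; exact: (bC y).2.
apply: (near_eq_is_derive _ (is_derive_cst (0 : R) x 1)).
have [x1'|x2'] := out _ x12 x1 x2; near=> y.
  rewrite bump_out// negb_and -!leNgt.
  apply/orP; left; apply/ltW; near: y; exact: lt_nbhsl.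
rewrite bump_out// negb_and -!leNgt.
apply/orP; right; apply/ltW; near: y; exact: lt_nbhsr.
Unshelve. all: by end_near. Qed.

(** Since 1 / x = window / den, dividing by x only changes numerator and exponent. At x = 0 both
    sides are 0, as 0 is off the support. *)
Lemma bump_divX P k x : bump P k x / x = bump (P * window) k.+1 x.
Proof.
have [x12|x12] := boolP (1 < x < 2); last by rewrite !bump_out// mul0r.
have w0 := window_gt0 _ x12.
have x0 : x != 0 by case/andP: x12 => x1 _; lra.
rewrite !bump_in// [den.[x]]hornerM hornerX [(P * window).[x]]hornerM exprS.
have D : (x * window.[x]) ^+ k != 0 by rewrite expf_neq0// mulf_neq0// gt_eqF.
move: D (expR _) => /=; move: (_ ^+ k) => dk D e.
by field; rewrite D x0 gt_eqF.
Qed.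

Lemma derive1_bump P k : derive1 (bump P k) = bump (bump' P k) k.+2.
Proof. by apply/funext => x; rewrite derive1E; have [_ ->] := is_derive_bump P k x. Qed.

Lemma smooth_bump P k : smooth (bump P k).
Proof.
move=> n x.
suff [Q [j ->]] : exists Q j, iter n (@derive1 R R) (bump P k) = bump Q j.
  by have [] := is_derive_bump Q j x.
elim: n => [|n [Q [j IH]]]; first by exists P, k.
by exists (bump' Q j), j.+2; rewrite iterS IH derive1_bump.
Qed.

Lemma compact_support_bump P k : compact_support (bump P k).
Proof.
exists 2 => x x2; rewrite bump_out//; apply/negP => /andP[x1 x2'].
by move: x2; rewrite ger0_norm; lra.
Qed.

Lemma continuous_bump P k : continuous (bump P k).
Proof.
move=> x; apply/differentiable_continuous/derivable1_diffP.
by have [] := is_derive_bump P k x.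
Qed.
End Bump.
Arguments window {R}.
Arguments bump {R} P k x.
Arguments bump' {R} P k.

(** * Square integrable real functions and their pairing *)

Section RealIntegrals.
Variable R : realType.
Local Notation leb := (@lebesgue_measure R).
Implicit Types u v w : R -> R.

Definition L2r u :=
  measurable_fun setT u /\ (\int[leb]_x ((u x) ^+ 2)%:E < +oo)%E.

Definition pairing u v : R := \int[leb]_x (u x * v x).

Lemma integrable_sqr u : L2r u -> leb.-integrable setT (EFin \o (fun x => u x ^+ 2)).
Proof.
move=> [mu uoo]; apply/integrableP; split.
  by apply/measurable_EFinP; exact: measurable_funX.
by under eq_integral do rewrite /= ger0_norm ?sqr_ge0//.
Qed.

Lemma normrM_le_half (a b : R) : `|a * b| <= 2^-1 * (a ^+ 2 + b ^+ 2).
Proof.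
have := sqr_ge0 (a + b); have := sqr_ge0 (a - b).
by rewrite ler_norml => *; apply/andP; split; nra.
Qed.

Lemma integrable_mul u v : L2r u -> L2r v ->
  leb.-integrable setT (EFin \o (fun x => u x * v x)).
Proof.
move=> u2 v2.
have uv : leb.-integrable setT (EFin \o (fun x => u x ^+ 2 + v x ^+ 2)).
  exact: integrableD (integrable_sqr _ u2) (integrable_sqr _ v2).
apply: le_integrable uv => //.
  by apply/measurable_EFinP; apply: measurable_funM; [case: u2|case: v2].
move=> x _ /=; rewrite lee_fin (le_trans (normrM_le_half _ _))//.
have := sqr_ge0 (u x); have := sqr_ge0 (v x); move=> *.
by rewrite [leRHS]ger0_norm; lra.
Qed.

(** The arithmetic-geometric mean inequality integrated: a substitute for Cauchy-Schwarz without
    square roots, sufficient for boundedness arguments. *)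
Lemma pairing_le u v : L2r u -> L2r v ->
  `|pairing u v| <= 2^-1 * (\int[leb]_x (u x ^+ 2) + \int[leb]_x (v x ^+ 2)).
Proof.
move=> u2 v2; apply: le_trans (le_normr_Rintegral _ (integrable_mul _ _ u2 v2)) _ => //.
have iD := integrableD measurableT (integrable_sqr _ u2) (integrable_sqr _ v2).
rewrite -(RintegralD _ (integrable_sqr _ u2) (integrable_sqr _ v2))//.
rewrite -(RintegralZl _ _ iD)//; apply: le_Rintegral => //.
- exact: (integrable_norm (integrable_mul _ _ u2 v2)).
- exact: (integrableZl _ _ iD).
- by move=> x _; exact: normrM_le_half.
Qed.

Lemma Rintegral_support u : (forall x : R, ~~ (1 < x < 2) -> u x = 0) ->
  \int[leb]_x u x = \int[leb]_(x in `[1, 2]) u x.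
Proof.
move=> u0; rewrite [RHS]Rintegral_mkcond; congr (Rintegral _ _ _).
apply/funext => x; rewrite patchE; case: ifPn => // x12.
apply: u0; apply: contra x12 => /andP[x1 x2]; rewrite inE /= in_itv /=.
by rewrite !ltW.
Qed.

Lemma integrable_supported u : continuous u ->
  (forall x, ~~ (1 < x < 2) -> u x = 0) -> leb.-integrable setT (EFin \o u).
Proof.
move=> cu u0.
have /integrable_mkcond : leb.-integrable `[1, 2] (EFin \o u).
  apply: continuous_compact_integrable; first exact: segment_compact.
  exact: continuous_subspaceT.
move=> /(_ (measurable_itv _)); rewrite (_ : (_ \_ _)%R = EFin \o u)//.
apply/funext => x; rewrite patchE; case: ifPn => //= x12.
rewrite u0//; apply: contra x12 => /andP[x1 x2]; rewrite inE /= in_itv /=.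
by rewrite !ltW.
Qed.

Lemma L2r_supported u : continuous u -> (forall x, ~~ (1 < x < 2) -> u x = 0) -> L2r u.
Proof.
move=> cu u0; split; first exact: continuous_measurable_fun.
have /integrableP[_] : leb.-integrable setT (EFin \o (fun x => u x ^+ 2)).
  apply: integrable_supported => [x|x x12]; last by rewrite u0 ?expr0n.
  exact: (continuous_comp (cu x) (@exprn_continuous _ 2 _)).
by under eq_integral do rewrite /= ger0_norm ?sqr_ge0//.
Qed.

(** Integrability is asked of the products, which covers square integrable factors as well as
    continuous functions paired with a bump. *)
Lemma pairing_linear (c : R) u v w :
  leb.-integrable setT (EFin \o (fun x => u x * w x)) ->
  leb.-integrable setT (EFin \o (fun x => v x * w x)) ->
  pairing (fun x => c * u x + v x) w = c * pairing u w + pairing v w.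
Proof.
move=> uw vw; rewrite /pairing -RintegralZl// -RintegralD//.
  by apply: eq_Rintegral => x _; rewrite mulrDl mulrA.
exact: (integrableZl _ _ uw).
Qed.

(** Both integrals reduce to [1, 2], and the boundary terms vanish: the support condition is strict,
    so w is 0 at 1 and at 2. *)
Lemma pairing_parts v v' w w' :
  (forall x : R, is_derive x 1 v (v' x)) -> continuous v' ->
  (forall x : R, is_derive x 1 w (w' x)) -> continuous w' ->
  (forall x : R, ~~ (1 < x < 2) -> w x = 0) -> (forall x : R, ~~ (1 < x < 2) -> w' x = 0) ->
  pairing v w' = - pairing v' w.
Proof.
move=> dv cv' dw cw' w0 w'0.
have oo (f f' : R -> R) : (forall x : R, is_derive x 1 f (f' x)) -> derivable_oo_LRcontinuous f (1:R) 2.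
  move=> df; have cf : continuous f.
    by move=> x; apply/differentiable_continuous/derivable1_diffP; case: (df x).
  split; [by move=> x _; case: (df x)|..].
    exact: cvg_at_right_filter (cf _).
  exact: cvg_at_left_filter (cf _).
rewrite /pairing !Rintegral_support; first last.
- by move=> x x12; rewrite w'0// mulr0.
- by move=> x x12; rewrite w0// mulr0.
rewrite (@Rintegration_by_parts _ v w v' w')//.
- by rewrite !w0 ?ltxx ?andbF// !mulr0 subrr sub0r.
- by rewrite ltrDl.
- exact: continuous_subspaceT.
- exact: oo dv.
- by move=> x _; rewrite derive1E; case: (dv x).
- exact: continuous_subspaceT.
- exact: oo dw.
- by move=> x _; rewrite derive1E; case: (dw x).
Qed.
End RealIntegrals.
Arguments L2r {R} u.
Arguments pairing {R} u v.

(** * The odd harmonic series and an abstract vanishing criterion for polynomials *)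

Section Divergence.
Local Open Scope ring_scope.
Variable R : realType.

(** As 1 / (2n + 1) >= 1 / (2 (n + 1)), a nonzero c would bound the harmonic series by 2 M / |c|. *)
Lemma odd_harmonic_unbounded (c M : R) :
  (forall N, `|\sum_(n < N) (2 * n + 1)%:R^-1 * c| <= M) -> c = 0.
Proof.
move=> cM; apply/eqP/negP => /negP c0.
have : cvgn (series (@harmonic R)).
  apply: (@nondecreasing_is_cvgn _ _ _).
    by apply: nondecreasing_series => n _ _; exact: harmonic_ge0.
  exists (2 * M / `|c|) => _ [N _ <-]; rewrite ler_pdivlMr ?normr_gt0//.
  rewrite -ler_pdivrMl// (le_trans _ (cM N))//.
  rewrite -mulr_suml normrM mulrA ler_wpM2r// ger0_norm; last first.
    by apply: sumr_ge0 => n _; rewrite invr_ge0.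
  rewrite /series /= big_mkord mulr_sumr ler_sum// => n _.
  rewrite /harmonic /= -invfM lef_pV2 ?posrE ?mulr_gt0 ?ltr0n ?addn1//.
  by rewrite -natrM ler_nat; lia.
exact: dvg_harmonic.
Qed.

Lemma deriv_eq0_const (Q : {poly R}) : Q^`() = 0 -> Q = (Q`_0)%:P.
Proof.
move=> dQ; apply/polyP => -[|i]; rewrite coefC//=.
have := coef_deriv Q i; rewrite dQ coef0 => /esym/eqP.
by rewrite mulrn_eq0 /= => /eqP.
Qed.

Section Bounded.
Variables (T : Type) (step : T -> T) (L : {poly R} -> T -> R) (a : R) (t0 : T).
Hypothesis L_lin : forall c P Q t, L (c *: P + Q) t = c * L P t + L Q t.
Hypothesis L_step : forall Q t, a * L Q (step t) = L (Q - (2 * a) *: Q^`()) t.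
Hypothesis L1 : L 1 t0 != 0.
Hypothesis a0 : a != 0.

(** Common form of the even and odd cases: L Q t is the pairing of the function built from Q with
    the test function encoded by t, and [step] encodes A. No alternating sign appears, as that of
    the series cancels against the powers of i. The bound may depend on t, but every t must have
    one, since passing to Q' also uses [step t]. *)
Definition bounded_sums (Q : {poly R}) := forall t, exists M, forall N,
  `|\sum_(n < N) (2 * n + 1)%:R^-1 * (a ^+ (2 * n + 1) * L Q (iter (2 * n + 1) step t))| <= M.

(** This is [L_step] solved for the term in Q'. *)
Lemma L_deriv Q t : L Q^`() t = (2 * a)^-1 * (L Q t - a * L Q (step t)).
Proof.
rewrite L_step (_ : Q - _ = (- (2 * a)) *: Q^`() + Q); last by rewrite scaleNr addrC.
by rewrite L_lin; field.
Qed.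

(** By [L_deriv], the sums of Q' at t are a fixed combination of those of Q at t and at [step t]. *)
Lemma bounded_sums_deriv Q : bounded_sums Q -> bounded_sums Q^`().
Proof.
move=> bQ t; have [M1 bM1] := bQ t; have [M2 bM2] := bQ (step t).
exists (`|(2 * a)^-1| * (M1 + `|a| * M2)) => N.
rewrite (eq_bigr (fun n : 'I_N => (2 * a)^-1 *
   ((2 * n + 1)%:R^-1 * (a ^+ (2 * n + 1) * L Q (iter (2 * n + 1) step t)) -
    a * ((2 * n + 1)%:R^-1 * (a ^+ (2 * n + 1) * L Q (iter (2 * n + 1) step (step t))))))); last first.
  by move=> n _; rewrite L_deriv -iterSr iterS; ring.
rewrite -mulr_sumr normrM ler_wpM2l// sumrB -mulr_sumr.
by rewrite (le_trans (ler_normB _ _))// lerD ?bM1// normrM ler_wpM2l ?bM2.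
Qed.

(** Induction on the size: Q' inherits the property and is smaller, hence Q' = 0 and Q is
    constant. *)
Lemma bounded_sums_eq0 Q : bounded_sums Q -> Q = 0.
Proof.
have [n] := ubnP (size Q); elim: n Q => // n IH Q sQ bQ.
have [-> //|Q0] := eqVneq Q 0.
have dQ : Q^`() = 0.
  by apply: IH (bounded_sums_deriv _ bQ); exact: leq_trans (lt_size_deriv Q0) sQ.
(* For constant Q, [L_step] says that a A leaves the pairing fixed, so the terms at [t0] are exactly
   L Q t0 / (2n + 1). *)
have Qc t m : a ^+ m * L Q (iter m step t) = L Q t.
  elim: m => [|m IHm]; first by rewrite mul1r.
  by rewrite exprSr -mulrA L_step dQ scaler0 subr0.
have [M bM] := bQ t0.
have : L Q t0 = 0.
  apply: (@odd_harmonic_unbounded _ M) => N; rewrite (le_trans _ (bM N))//.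
  by under [in leRHS]eq_bigr do rewrite Qc.
have L0 t : L 0 t = 0.
  by have := L_lin 1 0 0 t; rewrite scaler0 addr0 mul1r => /eqP; rewrite -subr_eq subrr => /eqP/esym.
have -> : Q = Q`_0 *: 1 + 0 by rewrite addr0 alg_polyC; exact: deriv_eq0_const.
rewrite L_lin L0 addr0 => /eqP; rewrite mulf_eq0 (negbTE L1) orbF => /eqP->.
by rewrite scale0r addr0.
Qed.
End Bounded.
End Divergence.
Arguments bounded_sums {R T} step L a Q.

(** * Even and odd polynomial multiples of the Gaussian, paired with bumps *)

Section GaussianPairing.
Variables (R : realType) (a : R).
Local Open Scope ring_scope.
Local Notation leb := (@lebesgue_measure R).
Hypothesis a0 : a != 0.
Implicit Types (P Q : {poly R}) (t : {poly R} * nat).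

Definition gauss Q (x : R) : R := Q.[x ^+ 2] * expR (- x ^+ 2 / (2 * a)).

(** Because Q is evaluated at x^2, a factor x splits off the derivative; it cancels the division by
    x in A, so the class of functions is preserved. *)
Lemma is_derive_gauss Q (x : R) :
  is_derive x 1 (gauss Q) (x * gauss (2 *: Q^`() - a^-1 *: Q) x).
Proof.
have -> : gauss Q = horner (Q \Po 'X^2) * (expR \o horner ((- (2 * a)^-1)%:P * 'X^2)).
  apply/funext => y; rewrite fctE horner_comp hornerXn; congr (_ * expR _).
  by rewrite hornerM hornerC hornerXn mulrC mulrN mulNr.
apply: is_derive_eq.
rewrite /gauss [(expR \o _) x]/comp !(horner_comp, hornerM, hornerC, hornerXn).
rewrite deriv_comp derivM derivC derivXn !(hornerD, hornerN, horner_comp, hornerM, hornerC, hornerXn, hornerMn, hornerZ).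
rewrite -![_ *: _]/(_ * _) -[2.-1]/1%N !expr1 -expr2.
rewrite (_ : - x ^+ 2 / _ = - (2 * a)^-1 * x ^+ 2); last by rewrite mulNr mulrC mulNr.
by field.
Qed.

Lemma continuous_gauss Q : continuous (gauss Q).
Proof.
move=> x; apply/differentiable_continuous/derivable1_diffP.
by have [] := is_derive_gauss Q x.
Qed.

Definition bump_of t : R -> R := bump t.1 t.2.

Lemma bump_of_out t x : ~~ (1 < x < 2) -> bump_of t x = 0.
Proof. exact: bump_out. Qed.

(* A pair t stands for psi = bump t.1 t.2; below are the pairs of (psi / x)' and
   of psi' / x. *)
Definition div_deriv t := (bump' (t.1 * window) t.2.+1, t.2.+3).
Definition deriv_div t := (bump' t.1 t.2 * window, t.2.+3).

Lemma integrable_bump (u : R -> R) t : continuous u ->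
  leb.-integrable setT (EFin \o (fun x => u x * bump_of t x)).
Proof.
move=> cu; apply: integrable_supported => [x|x x12]; last by rewrite bump_of_out ?mulr0.
apply: continuousM; [exact: cu|exact: continuous_bump].
Qed.

Lemma pairing_derive_bump (v v' : R -> R) P k :
  (forall x : R, is_derive x 1 v (v' x)) -> continuous v' ->
  pairing v (bump (bump' P k) k.+2) = - pairing v' (bump P k).
Proof.
move=> dv cv'; apply: (@pairing_parts _ _ _ _ _ dv cv').
- exact: is_derive_bump.
- exact: continuous_bump.
- by move=> x; exact: bump_out.
- by move=> x; exact: bump_out.
Qed.

Definition even_form Q t : R := pairing (gauss Q) (bump_of t).
Definition odd_form Q t : R := pairing (fun x => x * gauss Q x) (bump_of t).

Lemma gauss_linear (c : R) P Q x : gauss (c *: P + Q) x = c * gauss P x + gauss Q x.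
Proof. by rewrite /gauss hornerD hornerZ mulrDl mulrA. Qed.

Lemma even_form_linear (c : R) P Q t :
  even_form (c *: P + Q) t = c * even_form P t + even_form Q t.
Proof.
rewrite /even_form -pairing_linear; last 2 first.
- exact: integrable_bump (continuous_gauss _).
- exact: integrable_bump (continuous_gauss _).
by congr pairing; apply/funext => x; rewrite gauss_linear.
Qed.

Lemma continuous_mulX_gauss Q : continuous (fun x : R => x * gauss Q x).
Proof. by move=> x; apply: continuousM => //; exact: continuous_gauss. Qed.

Lemma odd_form_linear (c : R) P Q t :
  odd_form (c *: P + Q) t = c * odd_form P t + odd_form Q t.
Proof.
rewrite /odd_form -pairing_linear; last 2 first.
- exact: integrable_bump (continuous_mulX_gauss _).
- exact: integrable_bump (continuous_mulX_gauss _).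
by congr pairing; apply/funext => x; rewrite gauss_linear; ring.
Qed.

(** The trailing [+ 0] gives the right side the shape that the linearity lemmas rewrite. *)
Lemma gauss_step_poly Q :
  Q - (2 * a) *: Q^`() = - a *: (2 *: Q^`() - a^-1 *: Q) + 0.
Proof.
rewrite addr0 scalerBr !scalerA mulNr scaleNr mulNr mulfV// scaleN1r opprK addrC.
by rewrite [a * 2]mulrC.
Qed.

(** At x = 0 the bump vanishes, so the cancellation holds there too. *)
Lemma mulX_div_bump t x (y : R) : x * y * (bump_of t x / x) = y * bump_of t x.
Proof.
have [->|x0] := eqVneq x 0; last by field.
by rewrite bump_of_out ?mul0r ?mulr0// ltr10.
Qed.

(** Integrating by parts against (psi / x)' produces the factor x of [is_derive_gauss], which
    cancels 1 / x. *)
Lemma even_form_step Q t :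
  a * even_form Q (div_deriv t) = even_form (Q - (2 * a) *: Q^`()) t.
Proof.
rewrite gauss_step_poly even_form_linear.
have -> : even_form 0 t = 0.
  by have := even_form_linear 1 0 0 t; rewrite scaler0 addr0 mul1r; lra.
rewrite addr0 mulNr -mulrN; congr (_ * _); rewrite /even_form.
rewrite [LHS](pairing_derive_bump _ _ _ _ (is_derive_gauss Q) (continuous_mulX_gauss _)).
congr (- _); apply: eq_Rintegral => x _.
by rewrite -bump_divX mulX_div_bump.
Qed.

(** Here the prefactor x first cancels the 1 / x of psi' / x; integration by parts then restores it
    through [is_derive_gauss]. *)
Lemma odd_form_step Q t :
  a * odd_form Q (deriv_div t) = odd_form (Q - (2 * a) *: Q^`()) t.
Proof.
rewrite gauss_step_poly odd_form_linear.
have -> : odd_form 0 t = 0.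
  by have := odd_form_linear 1 0 0 t; rewrite scaler0 addr0 mul1r; lra.
rewrite addr0 mulNr -mulrN; congr (_ * _); rewrite /odd_form.
rewrite -(pairing_derive_bump _ _ _ _ (is_derive_gauss Q) (continuous_mulX_gauss _)).
apply: eq_Rintegral => x _.
rewrite /bump_of /= -bump_divX -/(bump_of (bump' t.1 t.2, t.2.+2) x).
by rewrite mulX_div_bump.
Qed.

(** A zero integral would make the nonnegative integrand vanish almost everywhere, yet it is
    positive on (1, 2), a set of measure 1. *)
Lemma pairing_gt0 (v : R -> R) : continuous v -> (forall x, 1 < x < 2 -> 0 < v x) ->
  0 < pairing v (bump_of (1, 0)).
Proof.
move=> cv v0; have iv := integrable_bump v (1, 0) cv.
have vb x : 1 < x < 2 -> 0 < v x * bump_of (1, 0) x.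
  by move=> x12; rewrite /bump_of bump_in// hornerC expr0 divr1 mul1r mulr_gt0 ?v0 ?expR_gt0.
have vb0 x : 0 <= v x * bump_of (1, 0) x.
  have [/vb/ltW//|x12] := boolP (1 < x < 2); by rewrite bump_of_out ?mulr0.
rewrite lt0r; apply/andP; split; last exact: Rintegral_ge0.
apply/negP => /eqP vb_eq0.
have : (\int[leb]_x `|(v x * bump_of (1, 0) x)%:E| = 0)%E.
  under eq_integral do rewrite gee0_abs ?lee_fin//.
  have fn := integrable_fin_num measurableT iv.
  by rewrite -(fineK fn); congr (_%:E).
move=> /(ae_eq_integral_abs _ measurableT (measurable_int _ iv)).1.
move=> [N [mN N0 sN]].
have : (leb `]1%R, 2%R[ <= leb N)%E.
  apply: le_measure; rewrite ?inE//; apply: subset_trans sN => x /=.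
  by rewrite in_itv /= => /vb vx /(_ I)[] /eqP; rewrite gt_eqF.
rewrite N0 lebesgue_measure_itv /= lte_fin ltrDl ltr01 -EFinB lee_fin; lra.
Qed.

Lemma even_form_neq0 : even_form 1 (1, 0) != 0.
Proof.
apply/lt0r_neq0/pairing_gt0; first exact: continuous_gauss.
by move=> x _; rewrite /gauss hornerC mul1r expR_gt0.
Qed.

Lemma odd_form_neq0 : odd_form 1 (1, 0) != 0.
Proof.
apply/lt0r_neq0/pairing_gt0; first exact: continuous_mulX_gauss.
move=> x /andP[x1 _]; rewrite /gauss hornerC mul1r mulr_gt0 ?expR_gt0//; lra.
Qed.

Lemma even_form_bounded Q : bounded_sums div_deriv even_form a Q -> Q = 0.
Proof.
exact: (bounded_sums_eq0 _ _ _ _ _ _ even_form_linear even_form_step even_form_neq0).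
Qed.

Lemma odd_form_bounded Q : bounded_sums deriv_div odd_form a Q -> Q = 0.
Proof.
exact: (bounded_sums_eq0 _ _ _ _ _ _ odd_form_linear odd_form_step odd_form_neq0).
Qed.
End GaussianPairing.
Arguments gauss {R} a Q x.
Arguments bump_of {R} t x.
Arguments div_deriv {R} t.
Arguments deriv_div {R} t.
Arguments even_form {R} a Q t.
Arguments odd_form {R} a Q t.

(** * Weak forms of the operator t and of its adjoint on bumps *)

Section WeakForms.
Variable R : realType.
Local Open Scope ring_scope.
Local Notation C := (R[i]).
Local Notation leb := (@lebesgue_measure R).
Implicit Types (f g h k : R -> C) (t : {poly R} * nat).

Lemma L2_re f : L2 f -> L2r (reF f).
Proof.
move=> [mr [mi fin]]; split=> //; apply: le_lt_trans fin.
apply: ge0_le_integral => //.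
- by move=> x _; rewrite lee_fin sqr_ge0.
- by apply/measurable_EFinP; exact: measurable_funX.
- by apply/measurable_EFinP; apply: measurable_funD; exact: measurable_funX.
- by move=> x _; rewrite lee_fin lerDl sqr_ge0.
Qed.

Lemma L2_im f : L2 f -> L2r (imF f).
Proof.
move=> [mr [mi fin]]; split=> //; apply: le_lt_trans fin.
apply: ge0_le_integral => //.
- by move=> x _; rewrite lee_fin sqr_ge0.
- by apply/measurable_EFinP; exact: measurable_funX.
- by apply/measurable_EFinP; apply: measurable_funD; exact: measurable_funX.
- by move=> x _; rewrite lee_fin lerDr sqr_ge0.
Qed.

Lemma L2_reim f : L2r (reF f) -> L2r (imF f) -> L2 f.
Proof.
move=> r2 i2; split; [by case: r2|split; first by case: i2].
rewrite /l2norm2; under eq_integral do rewrite EFinD.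
rewrite ge0_integralD//; first by apply: lte_add_pinfty; [case: r2|case: i2].
- by move=> x _; rewrite lee_fin sqr_ge0.
- by apply/measurable_EFinP; apply: measurable_funX; case: r2.
- by move=> x _; rewrite lee_fin sqr_ge0.
- by apply/measurable_EFinP; apply: measurable_funX; case: i2.
Qed.

Lemma L2r0 : L2r (fun _ : R => 0 : R).
Proof.
by split=> //; under eq_integral do rewrite expr0n; rewrite integral0.
Qed.

Lemma L2r_opp (u : R -> R) : L2r u -> L2r (fun x => - u x).
Proof.
move=> [mu fin]; split; first exact: measurable_funN.
by under eq_integral do rewrite sqrrN.
Qed.

Lemma L2r_bump P (n : nat) : L2r (@bump R P n).
Proof. by apply: L2r_supported => [|x]; [exact: continuous_bump|exact: bump_out]. Qed.

Lemma ae_impl (P Q : R -> Prop) : (forall x, P x -> Q x) ->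
  {ae leb, forall x, P x} -> {ae leb, forall x, Q x}.
Proof.
move=> PQ [N [mN N0 sN]]; exists N; split=> //; apply: subset_trans sN => x /=.
exact/contra_not/PQ.
Qed.

Lemma ae_pairing (u v w : R -> R) : measurable_fun setT u -> measurable_fun setT v ->
  measurable_fun setT w ->
  {ae leb, forall x, u x = v x} -> pairing u w = pairing v w.
Proof.
move=> mu mv mw uv; rewrite /pairing /Rintegral; congr fine.
apply: ae_eq_integral => //; try by apply/measurable_EFinP; exact: measurable_funM.
by apply: ae_impl uv => x + _ /= => ->.
Qed.

(* The real and imaginary parts of int k psi = i int f (A psi), where psi is
   encoded by t and A psi by step t. *)
Definition weak_step (T : op R) (step : {poly R} * nat -> {poly R} * nat) :=
  forall f k t, T f k ->
    pairing (reF k) (bump_of t) = - pairing (imF f) (bump_of (step t)) /\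
    pairing (imF k) (bump_of t) = pairing (reF f) (bump_of (step t)).

Lemma pairingZ (c : R) (u v : R -> R) : L2r u -> L2r v ->
  pairing (fun x => c * u x) v = c * pairing u v.
Proof.
move=> u2 v2; rewrite /pairing -RintegralZl//; last exact: integrable_mul.
by apply: eq_Rintegral => x _; rewrite mulrA.
Qed.

Lemma smooth0 : smooth (fun _ : R => 0 : R).
Proof.
move=> n x; suff -> : iter n (@derive1 R R) (fun=> 0) = fun=> 0 by exact: derivable_cst.
by elim: n => // n IH; rewrite iterS IH; apply/funext => y; rewrite derive1_cst.
Qed.

Lemma test_fun_bump P (n : nat) : test_fun (fun x => (bump P n x)%:C%C : C).
Proof.
split; first exact: smooth_bump.
split; first exact: smooth0.
split; first exact: compact_support_bump.
by exists 0.
Qed.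

Lemma cint_mul_real f (u : R -> R) :
  cint (fun x => f x * (u x)%:C%C) = (pairing (reF f) u +i* pairing (imF f) u)%C.
Proof.
rewrite /cint /pairing; congr (_ +i* _)%C; apply: eq_Rintegral => x _.
  by rewrite /reF; case: (f x) => p q /=; rewrite mulr0 subr0.
by rewrite /imF; case: (f x) => p q /=; rewrite mulr0 add0r.
Qed.

Lemma imF_muli f : imF (fun x => 'i%C * f x) = reF f.
Proof. by apply/funext => x; rewrite /imF /reF; case: (f x) => p q /=; rewrite mul0r mul1r add0r. Qed.

Lemma reF_muli f : reF (fun x => 'i%C * f x) = fun x => -1 * imF f x.
Proof. by apply/funext => x; rewrite /imF /reF; case: (f x) => p q /=; rewrite mul0r mul1r sub0r mulN1r. Qed.

(** With p f = g and g = x k, the definition of p is tested on psi / x: int k psi = int g (psi / x)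
    = i int f (psi / x)'. *)
Lemma top_weak_step : weak_step (@top R) div_deriv.
Proof.
move=> f k t [g [[f2 [g2 fg]] [k2 [_ gk]]]].
have := fg _ (test_fun_bump (t.1 * window) t.2.+1).
have -> : cderiv (fun x => (bump (t.1 * window) t.2.+1 x)%:C%C : C) =
    fun x => (bump_of (div_deriv t) x)%:C%C.
  apply/funext => x; rewrite /cderiv; congr (_ +i* _)%C.
    by rewrite /bump_of /= -derive1_bump.
  by rewrite derive1_cst.
rewrite !cint_mul_real => -[re im].
(* Moves the factor x from g onto the bump, separately for real and imaginary parts. *)
have ke (u v : R -> R) : L2r u -> L2r v -> {ae leb, forall x, v x = x * u x} ->
    pairing u (bump_of t) = pairing v (bump (t.1 * window) t.2.+1).
  move=> [mu _] [mv _] uv; have [mb _] := L2r_bump (t.1 * window) t.2.+1.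
  rewrite (ae_pairing _ _ _ mv _ mb uv); last exact: measurable_funM.
  by apply: eq_Rintegral => x _; rewrite -bump_divX mulX_div_bump.
have gkr : {ae leb, forall x, reF g x = x * reF k x}.
  apply: ae_impl gk => x gk; rewrite /reF gk.
  by case: (k x) => p q /=; rewrite mul0r subr0.
have gki : {ae leb, forall x, imF g x = x * imF k x}.
  apply: ae_impl gk => x gk; rewrite /imF gk.
  by case: (k x) => p q /=; rewrite mul0r addr0.
have L2g := L2_re _ g2; have L2g' := L2_im _ g2.
have Lb := L2r_bump (t.1 * window) t.2.+1.
rewrite (ke _ _ (L2_re _ k2) L2g gkr) (ke _ _ (L2_im _ k2) L2g' gki) re im.
by rewrite imF_muli reF_muli pairingZ// mulN1r !opprK.
Qed.

(** The second function is -i psi'. In the weak identity its factor -i meets the i of [pop], and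
    what remains is integration by parts with the bump as the supported factor. *)
Lemma pop_bump P (n : nat) : pop (fun x => (bump P n x)%:C%C : C)
  (fun x => (0 +i* - bump (bump' P n) n.+2 x)%C).
Proof.
have Lb := L2r_bump P n; have Lb' := L2r_bump (bump' P n) n.+2.
split; first by apply: L2_reim => //; exact: L2r0.
split.
  apply: L2_reim; first exact: L2r0.
  by rewrite /imF /=; exact: L2r_opp.
move=> phi [sr [si _]].
have cE (u : R -> R) (psi : R -> C) : cint (fun x => (u x)%:C%C * psi x) =
    (pairing (reF psi) u +i* pairing (imF psi) u)%C.
  by rewrite -cint_mul_real; congr cint; apply/funext => x; rewrite mulrC.
rewrite cE.
have -> : (fun x => 'i%C * (0 +i* - bump (bump' P n) n.+2 x)%C * phi x) =
    (fun x => (bump (bump' P n) n.+2 x)%:C%C * phi x).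
  by apply/funext => x; congr (_ * _); apply/eqP; rewrite eq_complex /=; apply/andP; split; apply/eqP; ring.
rewrite cE.
have sE (u : R -> R) : smooth u ->
    pairing (derive1 u) (bump P n) = - pairing u (bump (bump' P n) n.+2).
  move=> su.
  have du (x : R) : is_derive x 1 u (derive1 u x).
    by rewrite derive1E; apply: derivableP; exact: (su 0%N x).
  have cu : continuous (derive1 u).
    by move=> x; apply/differentiable_continuous/derivable1_diffP; exact: (su 1%N x).
  by rewrite (pairing_derive_bump _ _ _ _ _ du cu) opprK.
by rewrite /cderiv -[reF _]/(derive1 (reF phi)) -[imF (fun _ => _)]/(derive1 (imF phi)) !sE.
Qed.

(** Bumps lie in the domain of t because psi' vanishes near 0, so psi' / x is again a bump; they can
    therefore test the adjoint. *)
Lemma top_bump t : top (fun x => (bump_of t x)%:C%C : C)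
  (fun x => (0 +i* - bump_of (deriv_div t) x)%C).
Proof.
exists (fun x => (0 +i* - bump (bump' t.1 t.2) t.2.+2 x)%C).
have pb := pop_bump t.1 t.2; split=> //; have [_ [L2b _]] := pb.
split; last split=> //.
  apply: L2_reim; first exact: L2r0.
  by rewrite /imF /=; apply: L2r_opp; exact: L2r_bump.
apply: aeW => x; apply/eqP; rewrite eq_complex /= !mul0r subr0 mulr0 addr0 eqxx /=.
rewrite mulrN eqr_opp /bump_of /= -bump_divX mulrC.
have [->|x0] := eqVneq x 0; last by rewrite divfK.
by rewrite mulr0 bump_out// ltr10.
Qed.

(** The adjoint relation is tested on psi, whose image is -i psi' / x; conjugation in the inner
    product turns -i into i. *)
Lemma tstar_weak_step : weak_step (@tstar R) deriv_div.
Proof.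
move=> g h t [g2 [h2 gh]]; have := gh _ _ (top_bump t).
rewrite /inner.
have -> : (fun x => ((bump_of t x)%:C%C^* * h x)%C) = (fun x => h x * (bump_of t x)%:C%C).
  by apply/funext => x; case: (h x) => p q; apply/eqP; rewrite eq_complex /=; apply/andP; split; apply/eqP; ring.
have -> : (fun x => ((0 +i* - bump_of (deriv_div t) x)^* * g x)%C) =
    (fun x => 'i%C * g x * (bump_of (deriv_div t) x)%:C%C).
  by apply/funext => x; case: (g x) => p q; apply/eqP; rewrite eq_complex /=; apply/andP; split; apply/eqP; ring.
rewrite !cint_mul_real imF_muli reF_muli pairingZ ?mulN1r; last 2 first.
- exact: L2_im.
- exact: L2r_bump.
by case=> -> ->.
Qed.
End WeakForms.
Arguments weak_step {R} T step.

(** * Powers of the operators, bounds from convergence, parity, and the conclusion *)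

Section Domain.
Variable R : realType.
Local Open Scope ring_scope.
Local Notation C := (R[i]).
Local Notation leb := (@lebesgue_measure R).
Implicit Types (f g h k : R -> C) (t : {poly R} * nat).

Lemma reF_mulr (c : R) f : reF (fun x => c%:C%C * f x) = fun x => c * reF f x.
Proof. by apply/funext => x; rewrite /reF; case: (f x) => p q /=; rewrite mul0r subr0. Qed.

Lemma imF_mulr (c : R) f : imF (fun x => c%:C%C * f x) = fun x => c * imF f x.
Proof. by apply/funext => x; rewrite /imF; case: (f x) => p q /=; rewrite mul0r addr0. Qed.

Lemma L2r_bump_of t : L2r (bump_of t).
Proof. exact: L2r_bump. Qed.

Section Chain.
Variables (T : op R) (step : {poly R} * nat -> {poly R} * nat) (a : R).
Hypothesis TL2 : forall f k, T f k -> L2 k.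
Hypothesis Tstep : weak_step T step.

Lemma oppow_L2 n (S : op R) f h : oppow n S f h -> L2 h.
Proof. by elim: n f => [f [_ []]|n IH f [g [_ /IH]]]. Qed.

Lemma opscale_weak f h t : opscale a%:C%C T f h ->
  pairing (reF h) (bump_of t) = - (a * pairing (imF f) (bump_of (step t))) /\
  pairing (imF h) (bump_of t) = a * pairing (reF f) (bump_of (step t)).
Proof.
move=> [k [fk ->]]; have [re im] := Tstep _ _ t fk; have k2 := TL2 _ _ fk.
rewrite reF_mulr imF_mulr !pairingZ ?re ?im ?mulrN//.
- exact: L2_im.
- exact: L2r_bump_of.
- exact: L2_re.
- exact: L2r_bump_of.
Qed.

(** Each application contributes a factor i a and one A on the test function; i^(2n+1) = (-1)^n i
    exchanges real and imaginary parts. *)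
Lemma oppow_weak n f h t : oppow (2 * n + 1) (opscale a%:C%C T) f h ->
  pairing (reF h) (bump_of t) = - ((-1) ^+ n *
    (a ^+ (2 * n + 1) * pairing (imF f) (bump_of (iter (2 * n + 1) step t)))) /\
  pairing (imF h) (bump_of t) = (-1) ^+ n *
    (a ^+ (2 * n + 1) * pairing (reF f) (bump_of (iter (2 * n + 1) step t))).
Proof.
elim: n f => [f [g [fg [g2 [h2 gh]]]]|n IH f].
  (* The first power ends in [idop], so h agrees with the image of f only almost everywhere. *)
  have [re im] := opscale_weak _ _ t fg; rewrite !mul1r -re -im.
  have [mb _] := L2r_bump_of t.
  have [[mgr _] [mgi _]] := (L2_re _ _ g2, L2_im _ _ g2).
  have [[mhr _] [mhi _]] := (L2_re _ _ h2, L2_im _ _ h2).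
  split; apply/esym/ae_pairing => //; apply: ae_impl gh => x.
    by rewrite /reF => ->.
  by rewrite /imF => ->.
rewrite mulnS -addnA => -[g1 [fg1 [g2 [g12 /IH [hre him]]]]]; rewrite hre him {hre him}.
set m := (2 * n + 1)%N; set s := iter m step t.
(* [oppow] peels factors off on the side of f, so the two extra applications act on the test
   function after the other 2n + 1. *)
have [_ im2] := opscale_weak _ _ s g12; have [re2 _] := opscale_weak _ _ s g12.
have [re1 im1] := opscale_weak _ _ (step s) fg1.
rewrite im2 re2 re1 im1 !addSn !add0n !exprS !iterS -/s; split; ring.
Qed.
End Chain.

Lemma eventually_bounded (x : nat -> R) (M : R) :
  (\forall N \near \oo, `|x N| <= M) -> exists M', forall N, `|x N| <= M'.
Proof.
move=> [N0 _ xM]; exists (`|M| + \sum_(n < N0) `|x n|) => N.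
have [NN0|N0N] := ltnP N N0.
  rewrite (bigD1 (Ordinal NN0))//= addrCA lerDl addr_ge0//.
  exact: sumr_ge0.
rewrite (le_trans (xM _ N0N))// (le_trans (ler_norm M))// lerDl.
exact: sumr_ge0.
Qed.

Lemma pairingB (u v w : R -> R) : L2r u -> L2r v -> L2r w ->
  pairing u w = pairing (fun x => u x - v x) w + pairing v w.
Proof.
move=> u2 v2 w2; rewrite addrC.
rewrite (_ : (fun x => u x - v x) = (fun x => -1 * v x + u x)); last first.
  by apply/funext => x; rewrite mulN1r addrC.
by rewrite pairing_linear ?mulN1r; [rewrite addrA subrr add0r|exact: integrable_mul..].
Qed.

Lemma Rintegral_le1 (u v : R -> R) : L2r u -> (forall x, u x ^+ 2 <= v x) ->
  measurable_fun setT v -> (\int[leb]_x (v x)%:E <= 1)%E -> \int[leb]_x (u x ^+ 2) <= 1.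
Proof.
move=> u2 uv mv v1; have fn := integrable_fin_num measurableT (integrable_sqr _ _ u2).
rewrite -lee_fin /Rintegral fineK//; apply: le_trans v1; apply: ge0_le_integral => //.
- by move=> x _; rewrite lee_fin sqr_ge0.
- by apply/measurable_EFinP; apply: measurable_funX; case: u2.
- exact/measurable_EFinP.
- by move=> x _; rewrite lee_fin.
Qed.

(** Split u N = (u N - v) + v and apply [pairing_le] to the difference; the finitely many remaining
    N are absorbed in the constant. *)
Lemma pairing_eventually_bounded (u : nat -> R -> R) (v w : R -> R) :
  L2r v -> L2r w -> (forall N, L2r (u N)) ->
  (\forall N \near \oo, L2r (fun x => u N x - v x) /\
     \int[leb]_x ((u N x - v x) ^+ 2) <= 1) ->
  exists M, forall N, `|pairing (u N) w| <= M.
Proof.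
move=> v2 w2 u2 near1.
apply: (@eventually_bounded _ (2^-1 * (1 + \int[leb]_x (w x ^+ 2)) + `|pairing v w|)).
apply: filterS near1 => N [uv2 uv1].
rewrite (pairingB _ _ _ (u2 N) v2 w2) (le_trans (ler_normD _ _))// lerD2r.
by rewrite (le_trans (pairing_le _ _ _ uv2 w2))// ler_wpM2l ?invr_ge0// lerD2r.
Qed.

Lemma L2cvg_pairing_bounded (s : nat -> R -> C) g t : L2cvg s g ->
  (exists M, forall N, `|pairing (reF (s N)) (bump_of t)| <= M) /\
  (exists M, forall N, `|pairing (imF (s N)) (bump_of t)| <= M).
Proof.
move=> [g2 [s2 cvg]]; have b2 := L2r_bump_of t.
have near1 : \forall N \near \oo, (l2norm2 (fun x => (s N x - g x)%R) <= 1)%E.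
  have /fine_cvgP[fn fc] := cvg.
  near=> N.
  have fN : l2norm2 (fun x => s N x - g x) \is a fin_num by near: N.
  rewrite -(fineK fN) lee_fin; near: N.
  exact: (cvgr_le 0 fc _ ltr01).
have reB N : reF (fun x => s N x - g x) = fun x => reF (s N) x - reF g x.
  by apply/funext => x; rewrite /reF; case: (s N x) (g x) => [p q] [].
have imB N : imF (fun x => s N x - g x) = fun x => imF (s N) x - imF g x.
  by apply/funext => x; rewrite /imF; case: (s N x) (g x) => [p q] [].
have [[mgr _] [mgi _]] := (L2_re _ _ g2, L2_im _ _ g2).
(* The bound 1 on the norm itself supplies the finiteness needed for the difference to be in L2. *)
have B2 N : (l2norm2 (fun x => (s N x - g x)%R) <= 1)%E ->
    L2 (fun x => s N x - g x).
  have [[mr _] [mi _]] := (L2_re _ _ (s2 N), L2_im _ _ (s2 N)).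
  move=> le1; split; first by rewrite reB; exact: measurable_funB.
  split; first by rewrite imB; exact: measurable_funB.
  by apply: le_lt_trans le1 _; rewrite ltry.
have mB N : (l2norm2 (fun x => (s N x - g x)%R) <= 1)%E ->
    measurable_fun setT (fun x => reF (fun x => s N x - g x) x ^+ 2 + imF (fun x => s N x - g x) x ^+ 2).
  by move=> /B2[mr [mi _]]; apply: measurable_funD; exact: measurable_funX.
split.
  apply: (@pairing_eventually_bounded _ (reF g)) => //; first exact: L2_re.
    by move=> N; exact: L2_re.
  apply: filterS near1 => N le1; rewrite -reB; have := L2_re _ _ (B2 _ le1) => d2; split=> //.
  apply: (Rintegral_le1 _ _ _ _ (mB _ le1) le1) => [|x]; first by rewrite -reB.
  by rewrite [in leRHS]reB lerDl sqr_ge0.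
apply: (@pairing_eventually_bounded _ (imF g)) => //; first exact: L2_im.
  by move=> N; exact: L2_im.
apply: filterS near1 => N le1; rewrite -imB; have := L2_im _ _ (B2 _ le1) => d2; split=> //.
apply: (Rintegral_le1 _ _ _ _ (mB _ le1) le1) => [|x]; first by rewrite -imB.
by rewrite [in leRHS]imB lerDr sqr_ge0.
Unshelve. all: by end_near. Qed.

(** Norm convergence bounds the partial sums tested on any bump, and [oppow_weak] moves all
    operators onto the bump. The factor i makes imaginary parts of the sums control Re f, and real
    parts Im f. *)
Lemma Sdom_bounded (T : op R) step Lsub (eps : R) f (a := Num.sqrt eps) :
  (forall f k, T f k -> L2 k) -> weak_step T step -> Sdom T Lsub eps f ->
  (forall t, exists M, forall N, `|\sum_(n < N) (2 * n + 1)%:R^-1 *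
     (a ^+ (2 * n + 1) * pairing (reF f) (bump_of (iter (2 * n + 1) step t)))| <= M) /\
  (forall t, exists M, forall N, `|\sum_(n < N) (2 * n + 1)%:R^-1 *
     (a ^+ (2 * n + 1) * pairing (imF f) (bump_of (iter (2 * n + 1) step t)))| <= M).
Proof.
move=> TL2 wT [_ [_ [hs [hsP [g scvg]]]]].
have hs2 n : L2 (hs n) by exact: oppow_L2 (hsP n).
(* S N has N terms, so the convergent sequence is N |-> S N.+1; S 0 = 0 starts the inductions. *)
pose S N := fun x => \sum_(n < N) (((-1) ^+ n / (2 * n + 1)%:R)%:C)%C * hs n x.
have S2 N : L2 (S N).
  case: N => [|N]; last by case: scvg => _ [s2 _]; exact: (s2 N).
  rewrite /S; under eq_fun do rewrite big_ord0.
  by apply: L2_reim; exact: L2r0.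
have SS N x : S N.+1 x = (((-1) ^+ N / (2 * N + 1)%:R)%:C)%C * hs N x + S N x.
  by rewrite /S big_ord_recr addrC.
have re N t : pairing (reF (S N)) (bump_of t) = - \sum_(n < N) (2 * n + 1)%:R^-1 *
     (a ^+ (2 * n + 1) * pairing (imF f) (bump_of (iter (2 * n + 1) step t))).
  have b2 := L2r_bump_of t.
  elim: N => [|N IH].
    rewrite big_ord0 oppr0 /pairing; under eq_Rintegral do rewrite /reF /S big_ord0 mul0r.
    by rewrite Rintegral_cst ?mul0r.
  rewrite big_ord_recr /= opprD -IH addrC.
  have -> : reF (S N.+1) = fun x => (-1) ^+ N / (2 * N + 1)%:R * reF (hs N) x + reF (S N) x.
    apply/funext => x; rewrite /reF SS; case: (hs N x) (S N x) => [p q] [p' q'] /=.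
    by rewrite mul0r subr0.
  rewrite pairing_linear; [|exact: integrable_mul (L2_re _ _ _) b2..].
  have [-> _] := oppow_weak _ step a TL2 wT _ _ _ t (hsP N).
  (* The sign of the series coefficient and that of [oppow_weak] multiply to (-1)^(2N) = 1. *)
  by congr (_ + _); rewrite mulrN mulrAC mulrA -expr2 -exprM mulnC exprM sqrrN expr1n expr1n mul1r mulrC.
have im N t : pairing (imF (S N)) (bump_of t) = \sum_(n < N) (2 * n + 1)%:R^-1 *
     (a ^+ (2 * n + 1) * pairing (reF f) (bump_of (iter (2 * n + 1) step t))).
  have b2 := L2r_bump_of t.
  elim: N => [|N IH].
    rewrite big_ord0 /pairing; under eq_Rintegral do rewrite /imF /S big_ord0 mul0r.
    by rewrite Rintegral_cst ?mul0r.
  rewrite big_ord_recr /= -IH addrC.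
  have -> : imF (S N.+1) = fun x => (-1) ^+ N / (2 * N + 1)%:R * imF (hs N) x + imF (S N) x.
    apply/funext => x; rewrite /imF SS; case: (hs N x) (S N x) => [p q] [p' q'] /=.
    by rewrite mul0r addr0.
  rewrite pairing_linear; [|exact: integrable_mul (L2_im _ _ _) b2..].
  have [_ ->] := oppow_weak _ step a TL2 wT _ _ _ t (hsP N).
  by congr (_ + _); rewrite mulrAC mulrA -expr2 -exprM mulnC exprM sqrrN expr1n expr1n mul1r mulrC.
split => t.
  have [_ [M SM]] := L2cvg_pairing_bounded _ _ t scvg; exists (`|M|).
  case=> [|N]; first by rewrite big_ord0 normr0.
  by rewrite -im (le_trans (SM N))// ler_norm.
have [[M SM] _] := L2cvg_pairing_bounded _ _ t scvg; exists (`|M|).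
case=> [|N]; first by rewrite big_ord0 normr0.
by rewrite -normrN -re (le_trans (SM N))// ler_norm.
Qed.

Lemma finite_root_set (P : {poly R}) : P != 0 -> finite_set [set x | root P x].
Proof.
move=> P0; apply: contrapT => /(@infinite_set_fset _ _ (size P)) [B sB].
rewrite leqNgt => /negP; apply.
apply: max_poly_roots => //; last exact: finmap.fset_uniq.
by apply/allP => x xB; exact: sB.
Qed.

(** A nonzero polynomial has finitely many roots, a null set; together with the exceptional null set
    they would cover [0, 1]. *)
Lemma ae_poly_eq0 (P : {poly R}) : {ae leb, forall x, P.[x] = 0} -> P = 0.
Proof.
move=> Pae; apply/eqP/negP => /negP P0.
have croot := finite_set_countable (finite_root_set _ P0).
have mroot : measurable [set x | root P x] by apply: countable_measurable.
have nroot : leb.-negligible [set x | root P x].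
  by apply/negligibleP => //; exact: countable_lebesgue_measure0.
have : leb.-negligible `[0%R, 1%R].
  apply: negligibleS (negligibleU Pae nroot) => x _ /=.
  by have [/eqP Px|Px] := boolP (P.[x] == 0); [right; apply/eqP|left; apply/eqP].
move=> n01; have /eqP : leb `[0%R, 1%R] = 0%E.
  by apply: measure_negligible => //; exact: measurable_itv.
by rewrite lebesgue_measure_itv /= lte_fin ltr01 oppr0 adde0 eqe oner_eq0.
Qed.

(** Comparing P(x) with P(-x) kills the odd part almost everywhere, hence identically. The result
    has the form in x^2 that [gauss] expects. *)
Lemma poly_ae_even (P : {poly R}) : {ae leb, forall x, P.[- x] = P.[x]} ->
  P = even_poly P \Po 'X^2.
Proof.
move=> Pev; suff O0 : (odd_poly P \Po 'X^2) * 'X = 0.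
  by rewrite -[LHS]poly_even_odd O0 addr0.
apply: ae_poly_eq0; apply: ae_impl Pev => x.
rewrite -{1 2}(poly_even_odd P) !(hornerD, hornerXn, horner_comp, hornerM, hornerX) sqrrN.
lra.
Qed.

Lemma poly_ae_odd (P : {poly R}) : {ae leb, forall x, P.[- x] = - P.[x]} ->
  P = (odd_poly P \Po 'X^2) * 'X.
Proof.
move=> Pev; suff O0 : even_poly P \Po 'X^2 = 0.
  by rewrite -[LHS]poly_even_odd O0 add0r.
apply: ae_poly_eq0; apply: ae_impl Pev => x.
rewrite -{1 2}(poly_even_odd P) !(hornerD, hornerXn, horner_comp, hornerM, hornerX) sqrrN.
lra.
Qed.

Lemma Kspan_reim (eps : R) f : Kspan eps f -> exists P Q : {poly R}, forall x,
  f x = ((P.[x] * expR (- x ^+ 2 / (2 * Num.sqrt eps))) +i*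
         (Q.[x] * expR (- x ^+ 2 / (2 * Num.sqrt eps))))%C.
Proof.
move=> [N [c fE]].
suff [P [Q PQ]] : exists P Q : {poly R}, forall x : R,
    \sum_(i < N) c i * (x%:C%C) ^+ i = (P.[x] +i* Q.[x])%C.
  exists P, Q => x; rewrite fE -mulr_suml PQ.
  by apply/eqP; rewrite eq_complex /=; apply/andP; split; apply/eqP; ring.
elim: N c {fE} => [|N IH] c.
  by exists 0, 0 => x; rewrite big_ord0 !horner0.
have [P [Q PQ]] := IH (fun i => c (widen_ord (leqnSn N) i)).
exists (P + (complex.Re (c ord_max)) *: 'X^N), (Q + (complex.Im (c ord_max)) *: 'X^N) => x.
rewrite big_ord_recr /= PQ !hornerD !hornerZ !hornerXn -rmorphXn /=.
by case: (c ord_max) => p q /=; apply/eqP; rewrite eq_complex /=; apply/andP; split; apply/eqP; ring.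
Qed.

Lemma L2_0 : L2 (fun _ : R => 0 : C).
Proof. by apply: L2_reim; exact: L2r0. Qed.

Lemma top0 : top (fun _ : R => 0 : C) (fun _ => 0).
Proof.
have p0 : pop (fun _ : R => 0 : C) (fun _ => 0).
  split; [exact: L2_0|split; [exact: L2_0|]] => phi _.
  have c0 (u : R -> C) : cint (fun x => 0 * u x) = 0.
    rewrite /cint /Rintegral; under eq_integral do rewrite /reF mul0r.
    by under [in X in (_ +i* X)%C]eq_integral do rewrite /imF mul0r; rewrite integral0.
  rewrite c0; under [X in cint X]eq_fun do rewrite mulr0; by rewrite c0 oppr0.
exists (fun _ => 0); split=> //; split; [exact: L2_0|split; [exact: L2_0|]].
by apply: aeW => x; rewrite mulr0.
Qed.

Lemma tstar0 : tstar (fun _ : R => 0 : C) (fun _ => 0).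
Proof.
split; [exact: L2_0|split; [exact: L2_0|]] => f k _.
by rewrite /inner; congr cint; apply/funext => x; rewrite !mulr0.
Qed.

(** Serves the inclusion of {0} in the intersections: the zero function is every power, every term
    and the limit. *)
Lemma Sdom0 (T : op R) Lsub (eps : R) : T (fun _ => 0) (fun _ => 0) ->
  Lsub (fun _ => 0) -> Sdom T Lsub eps (fun _ => 0).
Proof.
move=> T0 Ls0.
have pow0 (S : op R) n : S (fun _ => 0) (fun _ => 0) -> oppow n S (fun _ => 0) (fun _ => 0).
  move=> S0; elim: n => [|n IH]; last by exists (fun _ => 0).
  by split; [exact: L2_0|split; [exact: L2_0|exact: aeW]].
split=> //; split=> [n|]; first by exists (fun _ => 0); exact: pow0.
exists (fun _ _ => 0); split=> [n|].
  by apply: pow0; exists (fun _ => 0); split=> //; apply/funext => x; rewrite mulr0.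
have s0 N : (fun x : R => \sum_(n < N.+1) (((-1) ^+ n / (2 * n + 1)%:R)%:C)%C * (0 : C)) = fun=> 0.
  by apply/funext => x; rewrite big1// => n _; rewrite mulr0.
exists (fun _ => 0); split; first exact: L2_0.
split=> [N|]; first by rewrite s0; exact: L2_0.
rewrite (_ : (fun N => _) = fun=> 0%E); first exact: cvg_cst.
apply/funext => N; rewrite /l2norm2; under eq_integral.
  by move=> x _; rewrite /reF /imF big1 ?subr0 /= ?expr0n ?addr0 /=; [over|move=> n _; rewrite mulr0].
by rewrite integral0.
Qed.

Lemma Kspan0 (eps : R) : Kspan eps (fun _ => 0).
Proof. by exists 0%N, (fun _ => 0) => x; rewrite big_ord0. Qed.

Lemma top_L2 f k : top f k -> L2 k.
Proof. by move=> [g [_ []]]. Qed.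

Lemma tstar_L2 f k : tstar f k -> L2 k.
Proof. by move=> [_ []]. Qed.

(** Real and imaginary parts are treated separately, each being a [gauss]. Since both polynomials
    are 0, f vanishes at every point and not merely almost everywhere. *)
Lemma DS_Kspan_eq0 (eps : R) f : 0 < eps -> Kspan eps f -> DS eps f -> f = fun _ => 0.
Proof.
move=> eps0 /Kspan_reim[P [Q fE]] Df; have [[_ fev] _] := Df.
have a0 : Num.sqrt eps != 0 by rewrite gt_eqF// sqrtr_gt0.
have e0 (x : R) : expR (- x ^+ 2 / (2 * Num.sqrt eps)) != 0 by rewrite gt_eqF// expR_gt0.
have PE : P = even_poly P \Po 'X^2.
  (* The Gaussian is even and never 0, so it cancels from the parity relation. *)
  apply: poly_ae_even; apply: ae_impl fev => x; rewrite !fE sqrrN => -[+ _].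
  by move=> xE; apply: (mulIf (e0 x)).
have QE : Q = even_poly Q \Po 'X^2.
  apply: poly_ae_even; apply: ae_impl fev => x; rewrite !fE sqrrN => -[_].
  by move=> xE; apply: (mulIf (e0 x)).
have [Bre Bim] := Sdom_bounded _ _ _ _ _ top_L2 (@top_weak_step R) Df.
have P0 : even_poly P = 0.
  apply: (even_form_bounded _ _ a0) => t; have [M HM] := Bre t; exists M => N.
  rewrite (le_trans _ (HM N))// (_ : reF f = gauss (Num.sqrt eps) (even_poly P))//.
  by apply/funext => x; rewrite /reF fE [in LHS]PE horner_comp hornerXn.
have Q0 : even_poly Q = 0.
  apply: (even_form_bounded _ _ a0) => t; have [M HM] := Bim t; exists M => N.
  rewrite (le_trans _ (HM N))// (_ : imF f = gauss (Num.sqrt eps) (even_poly Q))//.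
  by apply/funext => x; rewrite /imF fE [in LHS]QE horner_comp hornerXn.
by apply/funext => x; rewrite fE PE QE P0 Q0 comp_poly0 horner0 mul0r.
Qed.

(** Oddness splits off a factor x from both polynomials, which matches the prefactor in
    [odd_form]. *)
Lemma DSstar_Kspan_eq0 (eps : R) f : 0 < eps -> Kspan eps f -> DSstar eps f -> f = fun _ => 0.
Proof.
move=> eps0 /Kspan_reim[P [Q fE]] Df; have [[_ fodd] _] := Df.
have a0 : Num.sqrt eps != 0 by rewrite gt_eqF// sqrtr_gt0.
have e0 (x : R) : expR (- x ^+ 2 / (2 * Num.sqrt eps)) != 0 by rewrite gt_eqF// expR_gt0.
have PE : P = (odd_poly P \Po 'X^2) * 'X.
  apply: poly_ae_odd; apply: ae_impl fodd => x; rewrite !fE sqrrN => -[+ _].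
  by move=> xE; apply: (mulIf (e0 x)); rewrite [RHS]mulNr.
have QE : Q = (odd_poly Q \Po 'X^2) * 'X.
  apply: poly_ae_odd; apply: ae_impl fodd => x; rewrite !fE sqrrN => -[_].
  by move=> xE; apply: (mulIf (e0 x)); rewrite [RHS]mulNr.
have [Bre Bim] := Sdom_bounded _ _ _ _ _ tstar_L2 (@tstar_weak_step R) Df.
have P0 : odd_poly P = 0.
  apply: (odd_form_bounded _ _ a0) => t; have [M HM] := Bre t; exists M => N.
  rewrite (le_trans _ (HM N))// (_ : reF f = fun x => x * gauss (Num.sqrt eps) (odd_poly P) x)//.
  by apply/funext => x; rewrite /reF fE [in LHS]PE hornerM hornerX horner_comp hornerXn /gauss -[LHS]/(_ * _ * _); ring.
have Q0 : odd_poly Q = 0.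
  apply: (odd_form_bounded _ _ a0) => t; have [M HM] := Bim t; exists M => N.
  rewrite (le_trans _ (HM N))// (_ : imF f = fun x => x * gauss (Num.sqrt eps) (odd_poly Q) x)//.
  by apply/funext => x; rewrite /imF fE [in LHS]QE hornerM hornerX horner_comp hornerXn /gauss -[LHS]/(_ * _ * _); ring.
by apply/funext => x; rewrite fE PE QE P0 Q0 comp_poly0 mul0r horner0 mul0r.
Qed.

End Domain.

Theorem theorem3p9 (R : realType) (eps : R) :
  0 < eps <= 1 ->
  Kspan eps `&` DS eps = [set (fun _ => 0)] /\
  Kspan eps `&` DSstar eps = [set (fun _ => 0)].
Proof.
move=> /andP[eps0 _]; split; apply/seteqP; split=> f /=.
- by case; exact: DS_Kspan_eq0.
- move=> ->; split; first exact: Kspan0.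
  by apply: Sdom0; [exact: top0|split; [exact: L2_0|exact: aeW]].
- by case; exact: DSstar_Kspan_eq0.
- move=> ->; split; first exact: Kspan0.
  apply: Sdom0; [exact: tstar0|split; [exact: L2_0|]].
  by apply: aeW => x; rewrite oppr0.
Qed.
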